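(* Let $N$ and $r$ be positive integers, let $x_1,\ldots,x_r$ be complex variables and let $x=x_1+\cdots+x_r$. For any integer $n\geq r-1$, $$\sum_{\substack{i_1,\ldots,i_r\geq 0\\ i_1+\cdots+i_r=n}}\frac{n!}{i_1!\cdots i_r!}B_{N,i_1}(x_1)\cdots B_{N,i_r}(x_r)=\frac{1}{N^{r-1}}\sum_{i=0}^{r-1}A_r^{(N)}\bigl(i,x;1+N(r-1)-n\bigr)(-1)^i\binom{n}{i}\,i!\,B_{N,n-i}(x),$$ where $A_r^{(N)}(i,x;s)\in\mathbb{Q}[x,s]$ $(0\leq i\leq r-1)$ are the polynomials defined by the recurrence $$A_1^{(N)}(0,x;s)=1,$$ $$A_r^{(N)}(i,x;s)=\frac{s-1}{r-1}A_{r-1}^{(N)}(i,x;s-N)-\frac{x-(r-1)}{r-1}A_{r-1}^{(N)}(i-1,x;s-N+1)\qquad (r\geq 2),$$ with the convention that $A_r^{(N)}(i,x;s)=0$ for $i\leq -1$ and for $i\geq r$.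
   Context: For a positive integer $N$, the hypergeometric Bernoulli polynomials $B_{N,n}(x)$ ($n\geq 0$) are defined by the generating function $$\frac{t^N e^{xt}/N!}{e^t-T_{N-1}(t)}=\sum_{n=0}^{\infty}B_{N,n}(x)\frac{t^n}{n!},$$ where $T_{N-1}(t)=\sum_{k=0}^{N-1}\frac{t^k}{k!}$ is the Taylor polynomial of order $N-1$ of the exponential function. (The left-hand side is read as a power series in $t$: $e^t-T_{N-1}(t)=\frac{t^N}{N!}(1+\cdots)$, so the quotient is a well-defined power series.) *)

(* Defs.v *)
From HB Require Import structures.
From mathcomp Require Import all_boot all_order all_algebra.
From mathcomp Require Import polyXY.

Set Implicit Arguments.
Unset Strict Implicit.
Unset Printing Implicit Defensive.

Import Order.TTheory GRing.Theory Num.Theory.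
Local Open Scope ring_scope.

(* A formal power series over K in the variable t is represented by its
   sequence of coefficients [nat -> K], the n-th one being that of t^n. *)
Section PowerSeries.
Variable K : comUnitRingType.
Implicit Types f g u : nat -> K.

Definition fps_mul f g : nat -> K :=
  fun n => \sum_(i < n.+1) f i * g (n - i)%N.

Definition fps_mulXn (d : nat) f : nat -> K :=
  fun n => if (n < d)%N then 0 else f (n - d)%N.

Definition fps_divXn (d : nat) f : nat -> K := fun n => f (d + n)%N.

(* The first n coefficients of f / u, where u 0 is a unit, by long division:
   q_n = (f_n - \sum_(i < n) q_i u_(n-i)) / u_0. *)
Fixpoint fps_udiv_seq f u (n : nat) : seq K :=
  if n is m.+1 then
    let q := fps_udiv_seq f u m in
    rcons q ((f m - \sum_(i < m) q`_i * u (m - i)%N) * (u 0%N)^-1)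
  else [::].

Definition fps_udiv f u : nat -> K := fun n => (fps_udiv_seq f u n.+1)`_n.

(* f / g for g = t^d u and f divisible by t^d, where u 0 is a unit. *)
Definition fps_div (d : nat) f g : nat -> K :=
  fps_udiv (fps_divXn d f) (fps_divXn d g).

Lemma size_fps_udiv_seq f u n : size (fps_udiv_seq f u n) = n.
Proof. by elim: n => //= n IHn; rewrite size_rcons IHn. Qed.

Lemma nth_fps_udiv_seq f u n i :
  (i < n)%N -> (fps_udiv_seq f u n)`_i = fps_udiv f u i.
Proof.
elim: n => // n IHn; rewrite ltnS leq_eqVlt => /orP[/eqP-> //|lt_in].
by rewrite /= nth_rcons size_fps_udiv_seq lt_in IHn.
Qed.

Lemma fps_udivE f u n :
  fps_udiv f u n =
  (f n - \sum_(i < n) fps_udiv f u i * u (n - i)%N) * (u 0%N)^-1.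
Proof.
rewrite {1}/fps_udiv /= nth_rcons size_fps_udiv_seq ltnn eqxx.
by under eq_bigr => i _ do rewrite nth_fps_udiv_seq //.
Qed.

Lemma fps_udivK f u :
  u 0%N \is a GRing.unit -> fps_mul (fps_udiv f u) u =1 f.
Proof.
move=> u0 n; rewrite /fps_mul big_ord_recr /= subnn fps_udivE.
by rewrite divrK // addrC subrK.
Qed.

Lemma fps_udiv_uniq f u q :
  u 0%N \is a GRing.unit -> fps_mul q u =1 f -> q =1 fps_udiv f u.
Proof.
move=> u0 qu n; elim/ltn_ind: n => n IHn; rewrite fps_udivE -qu /fps_mul.
rewrite big_ord_recr /= subnn addrC.
under eq_bigr => i _ do rewrite IHn //.
by rewrite addrK mulrK.
Qed.

Lemma fps_mul_mulXn d f g :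
  fps_mul f (fps_mulXn d g) =1 fps_mulXn d (fps_mul f g).
Proof.
move=> n; rewrite /fps_mul /fps_mulXn; case: ltnP => [lt_nd|le_dn].
  by rewrite big1 // => i _; rewrite (leq_ltn_trans (leq_subr _ _)) // mulr0.
have [m ->] : exists m, n = (m + d)%N by exists (n - d)%N; rewrite subnK.
rewrite addnK.
rewrite -addSn big_split_ord /= [X in _ + X]big1 ?addr0 => [|i _].
  apply: eq_bigr => i _; have le_im : (i <= m)%N by rewrite -ltnS.
  by rewrite -addnBAC // ltnNge leq_addl /= addnK.
rewrite (_ : _ < d)%N ?mulr0 //.
by rewrite addSn -addnS subnDl ltn_subrL /= (leq_ltn_trans (leq0n i)).
Qed.

Lemma fps_mulXnK d f :
  (forall i, (i < d)%N -> f i = 0) -> fps_mulXn d (fps_divXn d f) =1 f.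
Proof.
move=> f0 n; rewrite /fps_mulXn /fps_divXn; case: ltnP => [/f0-> //|le_dn].
by rewrite subnKC.
Qed.

Lemma fps_divK d f g :
    (forall i, (i < d)%N -> f i = 0) -> (forall i, (i < d)%N -> g i = 0) ->
    g d \is a GRing.unit ->
  fps_mul (fps_div d f g) g =1 f.
Proof.
move=> f0 g0 gd n; rewrite -[RHS](fps_mulXnK f0).
transitivity (fps_mul (fps_div d f g) (fps_mulXn d (fps_divXn d g)) n).
  by apply: eq_bigr => i _; rewrite fps_mulXnK.
rewrite fps_mul_mulXn /fps_mulXn; case: ifP => // _.
by rewrite fps_udivK // /fps_divXn addn0.
Qed.

Lemma fps_div_uniq d f g q :
    (forall i, (i < d)%N -> g i = 0) -> g d \is a GRing.unit ->
  fps_mul q g =1 f -> q =1 fps_div d f g.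
Proof.
move=> g0 gd qg; apply: fps_udiv_uniq => [|n]; first by rewrite /fps_divXn addn0.
rewrite [RHS]/fps_divXn -qg.
transitivity (fps_mul q (fps_mulXn d (fps_divXn d g)) (d + n)).
  by rewrite fps_mul_mulXn /fps_mulXn ltnNge leq_addr /= addKn.
by apply: eq_bigr => i _; rewrite fps_mulXnK.
Qed.

End PowerSeries.

Section HypergeometricBernoulli.
Variable F : fieldType.
Implicit Types N n : nat.

(* Power series in t with coefficients in F[x]; here 'X is the variable x. *)
Definition fps_exp : nat -> {poly F} := fun n => (n`!%:R^-1)%:P.

Definition fps_expX : nat -> {poly F} := fun n => n`!%:R^-1 *: 'X^n.

(* T_(N-1)(t) = \sum_(k < N) t^k / k! *)
Definition fps_taylor_exp N : nat -> {poly F} :=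
  fun n => if (n < N)%N then (n`!%:R^-1)%:P else 0.

(* t^N e^(xt) / N! *)
Definition hbern_num N : nat -> {poly F} :=
  fun n => N`!%:R^-1 *: fps_mulXn N fps_expX n.

(* e^t - T_(N-1)(t), a series of order N with t^N-coefficient 1/N! *)
Definition hbern_den N : nat -> {poly F} :=
  fun n => fps_exp n - fps_taylor_exp N n.

Definition hbern N n : {poly F} :=
  n`!%:R *: fps_div N (hbern_num N) (hbern_den N) n.

End HypergeometricBernoulli.

Lemma natf_fact_neq0 (F : numFieldType) n : n`!%:R != 0 :> F.
Proof. by rewrite pnatr_eq0 -lt0n fact_gt0. Qed.

Lemma hbern_den_lt (F : fieldType) N i : (i < N)%N -> hbern_den F N i = 0.
Proof. by rewrite /hbern_den /fps_exp /fps_taylor_exp => ->; rewrite subrr. Qed.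

Lemma hbern_den_unit (F : numFieldType) N :
  hbern_den F N N \is a GRing.unit.
Proof.
rewrite /hbern_den /fps_exp /fps_taylor_exp ltnn subr0.
by rewrite poly_unitE size_polyC coefC /= unitfE !invr_eq0 !natf_fact_neq0.
Qed.

(* The generating function identity, which characterizes [hbern]. *)
Lemma hbern_gf (F : numFieldType) N :
  fps_mul (fun n => n`!%:R^-1 *: hbern F N n) (hbern_den F N)
    =1 hbern_num F N.
Proof.
move=> n.
transitivity
  (fps_mul (fps_div N (hbern_num F N) (hbern_den F N)) (hbern_den F N) n).
  apply: eq_bigr => i _; congr (_ * _).
  by rewrite /hbern scalerA mulVf ?natf_fact_neq0 // scale1r.
apply: fps_divK => [i lt_iN|i|]; last exact: hbern_den_unit.
  by rewrite /hbern_num /fps_mulXn lt_iN scaler0.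
exact: hbern_den_lt.
Qed.

Lemma hbern_gf_uniq (F : numFieldType) N (B : nat -> {poly F}) :
  fps_mul (fun n => n`!%:R^-1 *: B n) (hbern_den F N) =1 hbern_num F N ->
  B =1 hbern F N.
Proof.
move=> gfB n; rewrite /hbern.
rewrite -(fps_div_uniq (@hbern_den_lt F N) (hbern_den_unit F N) gfB n).
by rewrite scalerA mulfV ?natf_fact_neq0 // scale1r.
Qed.

(* A_r^(N)(i, x; s) as an element of Q[x][s]: the outer variable 'X is s and
   the inner variable 'Y (= 'X%:P) is x. The value at r = 0 is junk. *)
Fixpoint Apoly (N r : nat) (i : int) : {poly {poly rat}} :=
  if r is r1.+1 then
    if ~~ (0 <= i < r%:Z) then 0
    else if r1 == 0%N then 1
    else
      (r1%:R^-1)%:P *: (('X - 1) * (Apoly N r1 i \Po ('X - N%:R)))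
      - (r1%:R^-1)%:P *:
          (('Y - r1%:R) * (Apoly N r1 (i - 1) \Po ('X - N%:R + 1)))
  else 0.

(* The value at complex (or other numeric) x and s; in polyXY's
   p.[a, b], a is substituted for the outer and b for the inner variable. *)
Definition Aval (F : numFieldType) (N r : nat) (i : int) (x s : F) : F :=
  (map_poly (map_poly ratr) (Apoly N r i)).[s, x].

(* Main.v *)
Require Import Defs.
From mathcomp Require Import all_boot all_order all_algebra.
From mathcomp Require Import reals complex.
From mathcomp Require Import polyXY ring zify.
Import Order.TTheory GRing.Theory Num.Theory.
Local Open Scope ring_scope.

(** Write [g = t^N / N! / (e^t - T_(N-1)(t))], so that the left-hand side is
    [n!] times the coefficient of [t^n] in [g^r e^(xt)].  The series
    [u = (e^t - T_(N-1)(t)) / t^N] satisfies [t u' + N u = t u + 1 / (N-1)!],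
    whence [t g' = N g - t g - N g^2] and
    [N (r-1) g^r e^(xt) = (N (r-1) + (x - (r-1)) t) g^(r-1) e^(xt)
                          - t (g^(r-1) e^(xt))'].
    The coefficients of this identity satisfy the recurrence defining
    [A_r^(N)].  Series are represented by polynomials modulo
    ['X^(m.+1)], with [u] as [denP] and [g] as [hbernP 0]. *)

(** * Values of the polynomials $A_r^{(N)}$ *)

Section EvalA.
Variable F : numFieldType.

Definition evalXY (x s : F) (P : {poly {poly rat}}) : F :=
  (map_poly (map_poly ratr) P).[s, x].

Lemma evalXYB x s P Q : evalXY x s (P - Q) = evalXY x s P - evalXY x s Q.
Proof. by rewrite /evalXY rmorphB !hornerE. Qed.

Lemma evalXYM x s P Q : evalXY x s (P * Q) = evalXY x s P * evalXY x s Q.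
Proof. by rewrite /evalXY rmorphM !hornerM. Qed.

Lemma evalXYX x s : evalXY x s 'X = s.
Proof. by rewrite /evalXY map_polyX hornerX hornerC. Qed.

Lemma evalXYY x s : evalXY x s 'Y = x.
Proof. by rewrite /evalXY map_polyC /= hornerC map_polyX hornerX. Qed.

Lemma evalXY_nat x s n : evalXY x s n%:R = n%:R.
Proof. by rewrite /evalXY !(rmorph_nat, hornerMn, hornerC). Qed.

Lemma evalXY1 x s : evalXY x s 1 = 1.
Proof. exact: (evalXY_nat _ _ 1). Qed.

Lemma evalXYZ x s c P : evalXY x s (c%:P *: P) = ratr c * evalXY x s P.
Proof.
by rewrite /evalXY linearZ hornerZ hornerM /= map_polyC hornerC.
Qed.

(** Keeping [c] general, with constant image [c'], covers both shifts of the recurrence, $-N$ and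
    $-N+1$. *)
Lemma evalXY_shift x s P (c : {poly {poly rat}}) (c' : F) :
  map_poly (map_poly ratr) c = c'%:P%:P ->
  evalXY x s (P \Po ('X + c)) = evalXY x (s + c') P.
Proof.
move=> cE; rewrite /evalXY map_comp_poly horner_comp rmorphD /= cE.
by rewrite map_polyX hornerD hornerX hornerC -polyCD.
Qed.

Lemma Aval1 N (x s : F) : Aval N 1 0 x s = 1.
Proof. by rewrite /Aval /= !rmorph1 !hornerE. Qed.

Lemma Aval_out N r (i : int) (x s : F) :
  ~~ (0 <= i < r%:Z) -> Aval N r i x s = 0.
Proof.
by case: r => [|r] out; rewrite /Aval /= ?(negPf out) !rmorph0 !horner0.
Qed.

Lemma ApolyS N r (i : int) : 0 <= i < r.+2%:Z ->
  Apoly N r.+2 i =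
    (r.+1%:R^-1)%:P *: (('X - 1) * (Apoly N r.+1 i \Po ('X - N%:R)))
    - (r.+1%:R^-1)%:P *:
        (('Y - r.+1%:R) * (Apoly N r.+1 (i - 1) \Po ('X - N%:R + 1))).
Proof.
move=> i_in.
(* Exactly one unfolding of the fixpoint; simplification would also unfold the calls at [r.+1]. *)
transitivity (if ~~ (0 <= i < r.+2%:Z) then 0 else
    (r.+1%:R^-1)%:P *: (('X - 1) * (Apoly N r.+1 i \Po ('X - N%:R)))
    - (r.+1%:R^-1)%:P *:
        (('Y - r.+1%:R) * (Apoly N r.+1 (i - 1) \Po ('X - N%:R + 1)))).
  exact: erefl.
by rewrite i_in.
Qed.

Lemma AvalS N r (i : int) (x s : F) : 0 <= i < r.+2%:Z ->
  Aval N r.+2 i x s =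
    r.+1%:R^-1 * ((s - 1) * Aval N r.+1 i x (s - N%:R)
                  - (x - r.+1%:R) * Aval N r.+1 (i - 1) x (s - N%:R + 1)).
Proof.
move=> i_in; rewrite {1}/Aval ApolyS //.
rewrite -/(evalXY x s _) -[s - N%:R + 1]addrA.
rewrite !/(Aval _ r.+1 _ _ _) -!/(evalXY _ _ _).
move: (Apoly N r.+1 i) (Apoly N r.+1 (i - 1)) => P Q.
rewrite evalXYB !evalXYZ !evalXYM -addrA !evalXYB evalXYX evalXYY.
rewrite evalXY1 !evalXY_nat.
rewrite (evalXY_shift _ _ _ _ (- N%:R)); last first.
  by rewrite rmorphN rmorph_nat !polyCN !polyC_natr.
rewrite (evalXY_shift _ _ _ _ (- N%:R + 1)); last first.
  by rewrite rmorphD rmorphN rmorph1 rmorph_nat !polyCD !polyCN !polyC_natr.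
by rewrite fmorphV rmorph_nat -mulrBr.
Qed.

End EvalA.

(** * Congruence modulo $t^d$, expressed by divisibility *)

Lemma dvdXnP {F : fieldType} {d} {p : {poly F}} :
  reflect (forall i, (i < d)%N -> p`_i = 0) ('X^d %| p).
Proof.
apply: (iffP idP) => [/dvdpP[q ->] i id|p0].
  by rewrite coefMXn id.
apply/dvdpP; exists (drop_poly d p).
rewrite -{1}[p](poly_take_drop d) (_ : take_poly d p = 0) ?add0r //.
by apply/polyP=> i; rewrite coef_take_poly coef0; case: ifP => // /p0 ->.
Qed.

(** The factor ['X] restores the order lost by differentiating, so congruences modulo ['X^d] survive
    $t\,d/dt$. *)
Lemma dvdXn_deriv {F : fieldType} {d} {p : {poly F}} :
  'X^d %| p -> 'X^d %| 'X * p^`().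
Proof.
move=> /dvdXnP p0; apply/dvdXnP => -[|i] id; rewrite coefXM //=.
by rewrite coef_deriv p0 // mul0rn.
Qed.

Lemma factS_inv {F : numFieldType} k : k.+1%:R / k.+1`!%:R = k`!%:R^-1 :> F.
Proof.
by rewrite factS natrM invfM mulrA mulfV ?mul1r // pnatr_eq0.
Qed.

(** * Truncated generating functions and their differential equations *)

Section TruncatedSeries.
Variables (F : numFieldType) (N m : nat).
Hypothesis N_gt0 : (0 < N)%N.

Definition expP (x : F) : {poly F} := \poly_(i < m.+1) (x ^+ i / i`!%:R).
Definition denP : {poly F} := \poly_(i < m.+1) (N + i)`!%:R^-1.
Definition hbernP (x : F) : {poly F} :=
  \poly_(i < m.+1) ((hbern F N i).[x] / i`!%:R).

Lemma expP0 : expP 0 = 1.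
Proof.
apply/polyP => -[|i]; rewrite coef_poly coef1 /=.
  by rewrite expr0 fact0 divr1.
by rewrite expr0n mul0r if_same.
Qed.

Lemma expPD x y : 'X^(m.+1) %| expP x * expP y - expP (x + y).
Proof.
apply/dvdXnP => i im; rewrite coefB coefM coef_poly im; apply/eqP.
rewrite subr_eq0 addrC exprDn mulr_suml; apply/eqP/eq_bigr => j _.
have ji : (j <= i)%N by rewrite -ltnS.
rewrite !coef_poly !ifT; try lia.
rewrite -(bin_fact ji) !natrM -mulr_natr.
field.
by rewrite !natf_fact_neq0 pnatr_eq0 -lt0n bin_gt0.
Qed.

Lemma deriv_expP x : 'X^(m.+1) %| 'X * (expP x)^`() - x *: ('X * expP x).
Proof.
apply/dvdXnP => -[|i] im; rewrite coefB coefZ !coefXM /= ?mulr0 ?subrr //.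
rewrite coef_deriv !coef_poly im (ltnW im).
rewrite -[RHS](subrr (x * (x ^+ i / i`!%:R))).
congr (_ - _); rewrite -(factS_inv i) exprS -mulr_natr; ring.
Qed.

(** The factor $N+i$ turns $1/(N+i)!$ into $1/(N+i-1)!$, the previous coefficient of $u$; for $i=0$
    there is none, which leaves the constant $1/(N-1)!$. *)
Lemma deriv_denP :
  'X^(m.+1) %| 'X * denP^`() + N%:R *: denP - 'X * denP - (N.-1`!%:R^-1)%:P.
Proof.
apply/dvdXnP => i im; rewrite !(coefB, coefD, coefZ, coefXM, coefC).
case: i im => [|i] im /=.
  rewrite coef_poly /= addn0 -{1 2}(prednK N_gt0) factS_inv; ring.
rewrite coef_deriv !coef_poly im (ltnW im) subr0 addnS -(factS_inv (N + i)).
by rewrite -mulr_natr -addnS natrD; ring.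
Qed.

Lemma hbernP_gf x : 'X^(m.+1) %| hbernP x * denP - N`!%:R^-1 *: expP x.
Proof.
apply/dvdXnP => i im; rewrite coefB coefM coefZ [(expP x)`_i]coef_poly im.
apply/eqP; rewrite subr_eq0; apply/eqP.
pose f := fps_divXn N (hbern_num F N); pose u := fps_divXn N (hbern_den F N).
have u0 : u 0%N \is a GRing.unit by rewrite /u /fps_divXn addn0 hbern_den_unit.
(* The coefficients of the defining quotient are polynomials in $x$; the identity is evaluated at
   the given point. *)
have := congr1 (horner^~ x) (fps_udivK f u0 i).
rewrite /fps_mul horner_sum /f {2}/fps_divXn /hbern_num /fps_mulXn.
rewrite ltnNge leq_addr /= addKn !hornerZ hornerXn [x ^+ i / _]mulrC => <-.
apply: eq_bigr => j _; have ji : (j <= i)%N by rewrite -ltnS.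
rewrite !coef_poly !ifT; try lia.
rewrite hornerM /hbern hornerZ; congr (_ * _).
  by rewrite mulrAC mulfV ?natf_fact_neq0 // mul1r.
rewrite /u /fps_divXn /hbern_den /fps_exp /fps_taylor_exp.
by rewrite ltnNge leq_addr subr0 hornerC.
Qed.

(** The constant term $1/N!$ of $u$ is nonzero, so [denP] is coprime to ['X]. *)
Lemma cancel_denP p : 'X^(m.+1) %| p * denP -> 'X^(m.+1) %| p.
Proof.
rewrite Gauss_dvdpl // coprimep_expl // coprimep_sym coprimepX /root.
by rewrite horner_coef0 coef_poly invr_eq0 natf_fact_neq0.
Qed.

Lemma hbernPE x : 'X^(m.+1) %| hbernP x - hbernP 0 * expP x.
Proof.
apply: cancel_denP.
have Dx := hbernP_gf x.
have := hbernP_gf 0; rewrite expP0 => /(dvdp_mulr (expP x)) D0.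
have -> : (hbernP x - hbernP 0 * expP x) * denP =
  (hbernP x * denP - N`!%:R^-1 *: expP x)
  - (hbernP 0 * denP - N`!%:R^-1 *: 1) * expP x.
  rewrite -!mul_polyC; ring.
by rewrite dvdp_sub.
Qed.

(** Differentiating $gu=1/N!$ gives $tg'u=-g\,tu'$. Replace $tu'$ by [deriv_denP], write
    $1/(N-1)!=N/N!$ as $Ngu$, and cancel $u$. *)
Lemma deriv_hbernP0 (g := hbernP 0) :
  'X^(m.+1) %| 'X * g^`() - (N%:R *: g - 'X * g - N%:R *: g ^+ 2).
Proof.
apply: cancel_denP.
have := hbernP_gf 0; rewrite expP0 -/g => gu.
have := dvdXn_deriv gu; rewrite derivB derivM linearZ /= derivC scaler0 subr0.
have := deriv_denP.
have -> : N.-1`!%:R^-1 = N%:R * N`!%:R^-1 :> F.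
  by rewrite -{2 3}(prednK N_gt0) factS_inv.
rewrite -!mul_polyC in gu *; rewrite polyCM.
move: (N`!%:R^-1)%:P gu (N%:R)%:P => c gu k du dgu.
have -> : ('X * g^`() - (k * g - 'X * g - k * g ^+ 2)) * denP =
   'X * (g^`() * denP + g * denP^`())
   - g * ('X * denP^`() + k * denP - 'X * denP - k * c)
   + k * g * (g * denP - c * 1).
  ring.
by rewrite dvdp_add ?dvdp_sub // dvdp_mull.
Qed.

Lemma hbern_power_rec r x (G := fun r => hbernP 0 ^+ r * expP x) :
  'X^(m.+1) %| (N * r.+1)%:R *: G r.+2 - (N * r.+1)%:R *: G r.+1
     - (x - r.+1%:R) *: ('X * G r.+1) + 'X * (G r.+1)^`().
Proof.
have := deriv_expP x; have := deriv_hbernP0.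
rewrite /G derivM deriv_exp /= -[(_ * _) *+ _]mulr_natr.
rewrite -!mul_polyC !polyCB natrM polyCM !polyC_natr.
move: (x%:P) (N%:R) (r.+1%:R) (expP x) (hbernP 0) => y k c e g dg de.
have -> : k * c * (g ^+ r.+2 * e) - k * c * (g ^+ r.+1 * e) -
  (y - c) * ('X * (g ^+ r.+1 * e)) +
  'X * (g^`() * g ^+ r * c * e + g ^+ r.+1 * e^`()) =
  c * g ^+ r * e * ('X * g^`() - (k * g - 'X * g - k * g ^+ 2))
  + g ^+ r.+1 * ('X * e^`() - y * ('X * e)).
  rewrite !exprS; ring.
by rewrite dvdp_add ?dvdp_mull.
Qed.

Lemma coef_hbern_power_rec r x n (G := fun r => hbernP 0 ^+ r * expP x) :
  (n <= m)%N ->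
  N%:R * (n`!%:R * (G r.+2)`_n) =
    r.+1%:R^-1 * (((N * r.+1)%:R - n%:R) * (n`!%:R * (G r.+1)`_n)
    + (x - r.+1%:R) * (n%:R * (n.-1`!%:R * (G r.+1)`_n.-1))).
Proof.
move=> nm; have /dvdXnP/(_ n) := hbern_power_rec r x; rewrite ltnS => /(_ nm).
rewrite -!/(G _) !(coefB, coefD, coefZ, coefXM) coef_deriv natrM => E.
have r0 : r.+1%:R != 0 :> F by rewrite pnatr_eq0.
apply: (mulfI r0); rewrite mulVKf //; apply/subr0_eq.
transitivity (n`!%:R * 0 : F); last exact: mulr0.
(* At $n=0$ the value [n.-1 = 0] is harmless, being multiplied by $n$. *)
rewrite -[X in _ = _ * X]E; case: n {nm E} => [|n] /=; first ring.
rewrite factS natrM -mulr_natr; ring.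
Qed.

Lemma coef_prod_hbernP r (x_ : 'I_r -> F) n : (n <= m)%N ->
  (\prod_(k < r) hbernP (x_ k))`_n =
  (hbernP 0 ^+ r * expP (\sum_(k < r) x_ k))`_n.
Proof.
move=> nm; apply/eqP; rewrite -subr_eq0 -coefB; apply/eqP.
move: n nm; suff /dvdXnP D : 'X^(m.+1) %|
    \prod_(k < r) hbernP (x_ k) - hbernP 0 ^+ r * expP (\sum_(k < r) x_ k).
  by move=> n nm; apply: D.
elim: r x_ => [|r IHr] x_.
  by rewrite !big_ord0 expr0 mul1r expP0 subrr dvdp0.
rewrite !big_ord_recl.
have /= := IHr (fun k => x_ (lift ord0 k)).
move: (\prod_(_ < r) _) (\sum_(_ < r) _) => P y IH.
(* Telescoping: replace the tail product, then the first factor, then merge the two exponentials. *)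
have -> : hbernP (x_ ord0) * P - hbernP 0 ^+ r.+1 * expP (x_ ord0 + y) =
  hbernP (x_ ord0) * (P - hbernP 0 ^+ r * expP y) +
  hbernP 0 ^+ r * expP y * (hbernP (x_ ord0) - hbernP 0 * expP (x_ ord0))
  + hbernP 0 * hbernP 0 ^+ r * (expP (x_ ord0) * expP y - expP (x_ ord0 + y)).
  by rewrite exprS; ring.
by rewrite !dvdp_add ?dvdp_mull ?hbernPE ?expPD.
Qed.

Lemma coef_hbernP0_exp x n : (n <= m)%N ->
  n`!%:R * (hbernP 0 * expP x)`_n = (hbern F N n).[x].
Proof.
move=> nm; have /dvdXnP/(_ n) := hbernPE x; rewrite ltnS => /(_ nm).
rewrite coefB => /subr0_eq <-.
by rewrite coef_poly ltnS nm mulrCA mulfV ?natf_fact_neq0 // mulr1.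
Qed.

(** Induction on $r$. With $s=1+N(r+1)-n$, the factor $N(r+1)-n$ of [coef_hbern_power_rec] is $s-1$;
    the induction hypothesis at $n$ and $n-1$ uses the arguments $s-N$ and $s-N+1$, as in the
    recurrence for $A$. *)
Lemma coef_hbern_power r x n : (n <= m)%N ->
  N%:R ^+ r * (n`!%:R * (hbernP 0 ^+ r.+1 * expP x)`_n) =
  \sum_(i < r.+1) Aval N r.+1 i x (1 + (N * r)%:R - n%:R)
    * ((-1) ^+ i * (n ^_ i)%:R) * (hbern F N (n - i)).[x].
Proof.
elim: r n => [|r IHr] n nm.
  rewrite big_ord1 Aval1 subn0 ffactn0 expr0 !mul1r expr1.
  exact: coef_hbernP0_exp.
rewrite exprSr -mulrA coef_hbern_power_rec //.
set S := n`!%:R * _; set S' := n.-1`!%:R * _.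
have -> (k c d e : F) : N%:R ^+ r * (k * (c * S + d * (e * S'))) =
  k * (c * (N%:R ^+ r * S) + d * (e * (N%:R ^+ r * S'))) by ring.
rewrite {}/S {}/S' !IHr ?(leq_trans (leq_pred n)) //.
set s := 1 + (N * r.+1)%:R - n%:R.
(* The index of $A$ is kept apart from [j], because the second half of the recurrence pairs $A(i-1)$
   with the $i$-th Bernoulli term. *)
pose T (i : int) j s' := Aval N r.+1 i x s' * ((-1) ^+ j * (n ^_ j)%:R)
  * (hbern F N (n - j)).[x].
transitivity (\sum_(i < r.+2) r.+1%:R^-1 * ((s - 1) * T i%:Z i (s - N%:R)
   - (x - r.+1%:R) * T (i%:Z - 1) i (s - N%:R + 1))); last first.
  apply: eq_bigr => i _; rewrite AvalS; last by have := ltn_ord i; lia.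
  rewrite /T; ring.
rewrite -mulr_sumr sumrB -!mulr_sumr -mulrN /s mulnS natrD.
congr (_ * (_ * _ + _ * _)); first ring.
(* The extra top term has $A_{r+1}(r+1)=0$. *)
- rewrite [in RHS]big_ord_recr /= [X in _ = _ + X](_ : _ = 0) ?addr0.
    apply: eq_bigr => i _; rewrite /T; congr (Aval _ _ _ _ _ * _ * _); ring.
  by rewrite /T Aval_out ?mul0r // ltxx andbF.
(* The bottom term has $A_{r+1}(-1)=0$; the remaining ones are reindexed by $i+1$, which accounts
   for the sign. *)
- rewrite [in RHS]big_ord_recl {1}/T Aval_out // !mul0r add0r.
  rewrite mulr_sumr -sumrN; apply: eq_bigr => i _; rewrite /T.
  have -> : lift ord0 i = i.+1 :> nat by [].
  have -> : i.+1%:Z - 1 = i%:Z by lia.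
  case: n {nm T s} => [|k] /=; first by rewrite ffact0n !(mul0r, mulr0) oppr0.
  (* The falling factorial of $k+1$ absorbs the factor $n=k+1$ in front of the coefficient at
     $n-1$. *)
  rewrite ffactSS subSS (natrM _ k.+1) exprS.
  have -> : 1 + (N%:R + (N * r)%:R) - k.+1%:R - N%:R + 1 =
            1 + (N * r)%:R - k%:R :> F by rewrite -natr1; ring.
  ring.
Qed.

End TruncatedSeries.

(** * The multinomial sum as a coefficient of a product *)

Lemma coef_prod_poly (F : fieldType) (r n : nat) (a : 'I_r -> nat -> F) :
  (\prod_(k < r) \poly_(j < n.+1) a k j)`_n =
  \sum_(i : {ffun 'I_r -> 'I_n.+1} | (\sum_(k < r) i k)%N == n)
    \prod_(k < r) a k (i k).
Proof.
under eq_bigr => k _ do rewrite poly_def.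
(* Each function [i] selects one monomial from every factor. *)
rewrite bigA_distr_bigA coef_sum [RHS]big_mkcond; apply: eq_bigr => i _ /=.
rewrite scaler_prod prodrXr coefZ coefXn eq_sym.
by case: ifP => _; rewrite ?mulr1 ?mulr0.
Qed.

Theorem theorem1p2 (R : realType) (N r : nat) (hN : (0 < N)%N) (hr : (0 < r)%N)
    (x_ : 'I_r -> R[i]) (n : nat) (hn : (r - 1 <= n)%N) :
  let x := \sum_(k < r) x_ k in
  \sum_(i : {ffun 'I_r -> 'I_n.+1} | (\sum_(k < r) i k)%N == n)
      n`!%:R / (\prod_(k < r) (i k)`!)%:R
      * \prod_(k < r) (hbern _ N (i k)).[x_ k]
  = 1 / N%:R ^+ (r - 1)
    * \sum_(i < r)
        Aval N r i%:Z x (1 + (N * (r - 1))%:R - n%:R)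
        * (-1) ^+ i * 'C(n, i)%:R * i`!%:R * (hbern _ N (n - i)).[x].
Proof.
move=> x.
(* Truncation order $n$ suffices for the $n$-th coefficient and matches the index type ['I_n.+1]. *)
transitivity (n`!%:R * (\prod_(k < r) hbernP R[i] N n (x_ k))`_n).
  rewrite coef_prod_poly mulr_sumr; apply: eq_bigr => i _.
  by rewrite prodf_div natr_prod -mulrA; congr (_ * _); rewrite mulrC.
rewrite coef_prod_hbernP ?leqnn // -/x.
case: r hr {hn} x_ x => // r _ x_ x; rewrite subn1 /=.
have Nr0 : N%:R ^+ r != 0 :> R[i] by rewrite expf_neq0 // pnatr_eq0 -lt0n.
apply: (mulfI Nr0); rewrite coef_hbern_power // mul1r mulVKf //.
by apply: eq_bigr => i _; rewrite -bin_ffact (natrM _ 'C(_, _)) !mulrA.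
Qed.
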